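(* Under the setting described in the context, let $\{(x^j,y^j,z^j)\}_{j\ge0}$ be generated by the algorithm described there, and assume that $\sum_{j=1}^\infty\|z^{j+1}-z^j\|_2^2<\infty$ and that $\{z^j\}$ is bounded. Then $\{(x^j,y^j)\}$ is bounded, and every limit point $(\bar x,\bar y)$ of $\{(x^j,y^j)\}$ is a stationary point of the problem, i.e., there exists $\hat z\in\mathbb{R}^L$ with $$0\in\nabla f(\bar x)+\partial\mathcal{I}_{\mathcal{X}}(\bar x)-R^\top\hat z,\qquad 0\in\partial g(\bar y)+\partial\mathcal{I}_{\mathcal{Y}}(\bar y)+\hat z,\qquad \bar y=R\bar x .$$
   Context: Let $K,L\ge1$, $P_1,\dots,P_K\ge1$, $P=\sum_kP_k$. Let $R=(R_1,\dots,R_K)\in\{0,1\}^{L\times P}$ with $R_k\in\{0,1\}^{L\times P_k}$, every column of $R$ having at least one nonzero entry. Let $c\in\mathbb{R}^L$ with $c_l>0$, integers $1\le w_k\le P_k$, and constants $\alpha,\beta>0$, $s_k>0$. Vectors $x\in\mathbb{R}^P$ are partitioned as $x=(x_1;\dots;x_K)$ with $x_k\in\mathbb{R}^{P_k}$. Let $U_k(u)=\beta\log u-s_k/u$ for $u>0$. For $x\ge0$ define $f(x)=-\sum_{k}U_k(\|x_k\|_1)$ if $\|x_k\|_1>0$ for all $k$, and $f(x)=+\infty$ otherwise; let $g(y)=\alpha\max_l y_l/c_l$. Let $\mathcal{X}=\{x\in\mathbb{R}^P: x\ge0,\ \|x_k\|_0\le w_k\ \forall k\}$ and $\mathcal{Y}=\{y\in\mathbb{R}^L:0\le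 y\le c\}$, and let $\mathcal{I}_S$ denote the indicator function of a set $S$ ($0$ on $S$, $+\infty$ off $S$). The problem is $\min_{x,y} f(x)+g(y)+\mathcal{I}_{\mathcal{X}}(x)+\mathcal{I}_{\mathcal{Y}}(y)$ s.t. $y=Rx$, with augmented Lagrangian $$L_\rho(x,y;z)=f(x)+g(y)+\mathcal{I}_{\mathcal{X}}(x)+\mathcal{I}_{\mathcal{Y}}(y)+z^\top(y-Rx)+\frac{\rho}{2}\|y-Rx\|_2^2 .$$ Algorithm: fix $\rho>0$ and $\mu>\rho\|R\|_2^2$ ($\|R\|_2$ the spectral norm), and an initial point $(x^0,y^0,z^0)$ with $x^0\in\mathcal{X}$, $\|x^0_k\|_1>0$ for all $k$, $y^0\in\mathcal{Y}$. For $j\ge0$: $q^j=R^\top(y^j-Rx^j+z^j/\rho)$, $\nu^j=x^j+(\rho/\mu)q^j$; $x^{j+1}\in\arg\min_{x\in\mathcal{X}} f(x)+\frac{\mu}{2}\|x-\nu^j\|_2^2$; $y^{j+1}\in\arg\min_{y\in\mathcal{Y}} g(y)+\frac{\rho}{2}\|y-Rx^{j+1}+z^j/\rho\|_2^2$; $z^{j+1}=z^j+\rho(y^{j+1}-Rx^{j+1})$. Here $\partial$ denotes the limiting (Mordukhovich) subdifferential, and $\nabla f$ the gradient of $f$ at points where all blocks $x_k$ have $\|x_k\|_1>0$. *)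

(* Defs.v *)
From HB Require Import structures.
From mathcomp Require Import all_boot all_order all_algebra.
From mathcomp Require Import all_classical all_reals all_analysis.
Set Implicit Arguments. Unset Strict Implicit. Unset Printing Implicit Defensive.
Import Order.TTheory GRing.Theory Num.Theory.
Local Open Scope classical_set_scope.
Local Open Scope ring_scope.

Section Defs.
Variable R : realType.

Definition inner n (v w : 'cV[R]_n) : R := \sum_i v i 0 * w i 0.
Definition sqnorm n (v : 'cV[R]_n) : R := \sum_i (v i 0) ^+ 2.
Definition norm2 n (v : 'cV[R]_n) : R := Num.sqrt (sqnorm v).

Definition specnorm m n (A : 'M[R]_(m, n)) : R :=
  sup [set norm2 (A *m v) | v in [set v : 'cV[R]_n | norm2 v <= 1]].

Definition vcvg n (u : nat -> 'cV[R]_n) (a : 'cV[R]_n) : Prop :=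
  forall eps : R, 0 < eps -> exists N : nat, forall k, (N <= k)%N -> norm2 (u k - a) < eps.
Definition vbounded n (u : nat -> 'cV[R]_n) : Prop :=
  exists M : R, forall k, norm2 (u k) <= M.
Definition limit_point2 m n (x : nat -> 'cV[R]_m) (y : nat -> 'cV[R]_n)
  (xb : 'cV[R]_m) (yb : 'cV[R]_n) : Prop :=
  exists phi : nat -> nat, (forall k, (phi k < phi k.+1)%N) /\
    vcvg (fun k => x (phi k)) xb /\ vcvg (fun k => y (phi k)) yb.

Definition frechet_subgrad n (h : 'cV[R]_n -> \bar R) (x v : 'cV[R]_n) : Prop :=
  h x \is a fin_num /\
  forall eps : R, 0 < eps -> exists delta : R, 0 < delta /\
    forall u, norm2 (u - x) < delta ->
      ((fine (h x) + inner v (u - x) - eps * norm2 (u - x))%:E <= h u)%E.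

Definition limiting_subgrad n (h : 'cV[R]_n -> \bar R) (x v : 'cV[R]_n) : Prop :=
  h x \is a fin_num /\
  exists (xs vs : nat -> 'cV[R]_n),
    vcvg xs x /\
    (forall k, frechet_subgrad h (xs k) (vs k)) /\
    (forall eps : R, 0 < eps -> exists N : nat, forall k, (N <= k)%N ->
       `|fine (h (xs k)) - fine (h x)| < eps) /\
    vcvg vs v.

Definition is_gradient n (F : 'cV[R]_n -> R) (x v : 'cV[R]_n) : Prop :=
  forall eps : R, 0 < eps -> exists delta : R, 0 < delta /\
    forall u, norm2 (u - x) < delta ->
      `|F u - F x - inner v (u - x)| <= eps * norm2 (u - x).

Definition eindic n (S : pred 'cV[R]_n) (x : 'cV[R]_n) : \bar R :=
  if S x then 0%E else +oo%E.

(* ---- problem data: blocks given by a nondecreasing surjection blk : 'I_P -> 'I_K ---- *)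
Variables (K L P : nat) (blk : 'I_P -> 'I_K).

Definition blocksize (k : 'I_K) : nat := #|[set i | blk i == k]|.
Definition bnorm1 (x : 'cV[R]_P) (k : 'I_K) : R := \sum_(i | blk i == k) `|x i 0|.
Definition bnorm0 (x : 'cV[R]_P) (k : 'I_K) : nat := #|[set i | (blk i == k) && (x i 0 != 0)]|.
Definition bsum (x : 'cV[R]_P) (k : 'I_K) : R := \sum_(i | blk i == k) x i 0.

Definition Uk (beta : R) (s : 'I_K -> R) (k : 'I_K) (u : R) : R := beta * ln u - s k / u.

Definition fobj (beta : R) (s : 'I_K -> R) (x : 'cV[R]_P) : \bar R :=
  if [forall k, 0 < bnorm1 x k] then (- \sum_k Uk beta s k (bnorm1 x k))%:E else +oo%E.

(* smooth expression of f on x >= 0 (||x_k||_1 = 1^T x_k there); its gradient is nabla f *)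
Definition fsmooth (beta : R) (s : 'I_K -> R) (x : 'cV[R]_P) : R :=
  - \sum_k Uk beta s k (bsum x k).

Definition gobj (alpha : R) (c : 'cV[R]_L) (y : 'cV[R]_L) : \bar R :=
  (alpha%:E * \big[Order.max/-oo%E]_l (y l 0 / c l 0)%:E)%E.

Definition inX (w : 'I_K -> nat) (x : 'cV[R]_P) : bool :=
  [forall i, 0 <= x i 0] && [forall k, (bnorm0 x k <= w k)%N].
Definition inY (c : 'cV[R]_L) (y : 'cV[R]_L) : bool :=
  [forall l, (0 <= y l 0) && (y l 0 <= c l 0)].

End Defs.

(* Main.v *)
Require Import Defs.
From HB Require Import structures.
From mathcomp Require Import all_boot all_order all_algebra.
From mathcomp Require Import all_classical all_reals all_analysis.
From mathcomp Require Import ring lra.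
Set Implicit Arguments. Unset Strict Implicit. Unset Printing Implicit Defensive.
Import Order.TTheory GRing.Theory Num.Theory numFieldNormedType.Exports.
Local Open Scope classical_set_scope.
Local Open Scope ring_scope.

(** The augmented Lagrangian decreases along the iterations up to the summable
    errors [|z^(j+1) - z^j|^2 / rho]: linearising the quadratic term in the x-step
    costs at most [rho |R|^2 / 2 |dx|^2], which the proximal term
    [mu / 2 |dx|^2] dominates.  Boundedness of [z] and of [Y] bounds [R x], hence
    [x >= 0] since [R] is a 0/1 matrix without zero column, so the Lagrangian is
    bounded below.  It follows that [x^(j+1) - x^j] and [y^j - R x^j] tend to 0,
    and that [f (x^j)] is bounded above; as [s_k / u] blows up at [u = 0], the
    block sums stay away from 0.

    Passing to the limit in the two argmin inequalities along an ultrafilter shows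
    that [xb] and [yb] solve the limiting subproblems.  The first gives a Frechet
    normal to the nonconvex set [X] at once.  The second is a convex problem whose
    multipliers on the max term and on the box are written down explicitly. *)

(** * Euclidean geometry and the spectral norm bound *)

Section Euclidean.
Context {R : realType}.

Lemma sqnorm_ge0 n (v : 'cV[R]_n) : 0 <= sqnorm v.
Proof. by apply: sumr_ge0 => i _; exact: sqr_ge0. Qed.

Lemma norm2_ge0 n (v : 'cV[R]_n) : 0 <= norm2 v.
Proof. exact: sqrtr_ge0. Qed.

Lemma norm2_sq n (v : 'cV[R]_n) : norm2 v ^+ 2 = sqnorm v.
Proof. by rewrite sqr_sqrtr// sqnorm_ge0. Qed.

Lemma coord_le_norm2 n (v : 'cV[R]_n) i : `|v i 0| <= norm2 v.
Proof.
rewrite -sqrtr_sqr ler_wsqrtr// /sqnorm (bigD1 i)//= lerDl.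
by apply: sumr_ge0 => j _; exact: sqr_ge0.
Qed.

Lemma norm2_le_sum n (v : 'cV[R]_n) : norm2 v <= \sum_i `|v i 0|.
Proof.
have S0 : 0 <= \sum_i `|v i 0| by apply: sumr_ge0.
rewrite -(ger0_norm S0) -sqrtr_sqr ler_wsqrtr// expr2 mulr_suml.
apply: ler_sum => i _; rewrite -real_normK ?num_real// expr2 ler_wpM2l//.
by rewrite (bigD1 i)//= lerDl sumr_ge0.
Qed.

Lemma norm2Z n (a : R) (v : 'cV[R]_n) : norm2 (a *: v) = `|a| * norm2 v.
Proof.
rewrite /norm2 /sqnorm -sqrtr_sqr -sqrtrM ?sqr_ge0// mulr_sumr.
by congr Num.sqrt; apply: eq_bigr => i _; rewrite mxE exprMn.
Qed.

Lemma inner_sqnorm n (v : 'cV[R]_n) : inner v v = sqnorm v.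
Proof. by apply: eq_bigr => i _; rewrite expr2. Qed.

Lemma innerDl n (u v w : 'cV[R]_n) : inner (u + v) w = inner u w + inner v w.
Proof. by rewrite /inner -big_split; apply: eq_bigr => i _; rewrite mxE mulrDl. Qed.

Lemma innerZl n (a : R) (v w : 'cV[R]_n) : inner (a *: v) w = a * inner v w.
Proof. by rewrite /inner mulr_sumr; apply: eq_bigr => i _; rewrite mxE mulrA. Qed.

Lemma innerNl n (v w : 'cV[R]_n) : inner (- v) w = - inner v w.
Proof. by rewrite -scaleN1r innerZl mulN1r. Qed.

Lemma innerC n (v w : 'cV[R]_n) : inner v w = inner w v.
Proof. by apply: eq_bigr => i _; rewrite mulrC. Qed.

Lemma inner_trmx m n (A : 'M[R]_(m, n)) v w :
  inner (A^T *m v) w = inner v (A *m w).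
Proof.
rewrite /inner; under eq_bigr do rewrite mxE mulr_suml.
under [RHS]eq_bigr do rewrite mxE mulr_sumr.
rewrite exchange_big; apply: eq_bigr => i _; apply: eq_bigr => j _.
by rewrite mxE mulrA [A i j * _]mulrC.
Qed.

Lemma sqnormD n (u v : 'cV[R]_n) :
  sqnorm (u + v) = sqnorm u + 2 * inner u v + sqnorm v.
Proof.
rewrite /sqnorm /inner mulr_sumr -!big_split; apply: eq_bigr => i _ /=.
by rewrite mxE; ring.
Qed.

Lemma sqnormZ n (a : R) (v : 'cV[R]_n) : sqnorm (a *: v) = a ^+ 2 * sqnorm v.
Proof. by rewrite /sqnorm mulr_sumr; apply: eq_bigr => i _; rewrite mxE exprMn. Qed.

Lemma sqnormN n (v : 'cV[R]_n) : sqnorm (- v) = sqnorm v.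
Proof. by rewrite -scaleN1r sqnormZ sqrrN expr1n mul1r. Qed.

Lemma norm2_mulmx_le m n (A : 'M[R]_(m, n)) (v : 'cV[R]_n) :
  norm2 (A *m v) <= specnorm A * norm2 v.
Proof.
(* The supremum dominates its set only once that set is known to be bounded; on the unit ball the
   sum of all [|A l i|] is a crude bound. *)
have hub : has_ubound
    [set norm2 (A *m v) | v in [set v : 'cV[R]_n | norm2 v <= 1]].
  exists (\sum_l \sum_i `|A l i|) => _ [u /= u1 <-].
  apply: (le_trans (norm2_le_sum _) _); apply: ler_sum => l _.
  rewrite mxE; apply: (le_trans (ler_norm_sum _ _ _) _); apply: ler_sum => i _.
  by rewrite normrM ler_piMr// (le_trans (coord_le_norm2 u i)).
have [v0|v0] := eqVneq (norm2 v) 0.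
  rewrite v0 mulr0; suff -> : v = 0.
    by rewrite mulmx0 -(scale0r (0 : 'cV[R]_m)) norm2Z normr0 mul0r.
  apply/matrixP => i j; rewrite mxE (ord1 j); apply/eqP; rewrite -normr_eq0.
  by rewrite eq_le normr_ge0 andbT -v0 coord_le_norm2.
have vp : 0 < norm2 v by rewrite lt_neqAle eq_sym v0 norm2_ge0.
rewrite -ler_pdivrMr//; apply: (ub_le_sup hub).
exists ((norm2 v)^-1 *: v); last first.
  by rewrite -scalemxAr norm2Z gtr0_norm ?invr_gt0// mulrC.
by rewrite /= norm2Z gtr0_norm ?invr_gt0// mulVf.
Qed.

Lemma sqnorm_mulmx_le m n (A : 'M[R]_(m, n)) (v : 'cV[R]_n) :
  sqnorm (A *m v) <= specnorm A ^+ 2 * sqnorm v.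
Proof.
have Av := norm2_mulmx_le A v.
rewrite -!norm2_sq -exprMn; apply: lerXn2r => //; rewrite nnegrE.
  exact: norm2_ge0.
exact: (le_trans (norm2_ge0 _) Av).
Qed.

End Euclidean.

(** * Coordinatewise limits along filters *)

Section CoordinatewiseLimits.
Context {R : realType} {T : Type} {F : set_system T} {FF : ProperFilter F}.

(** An arbitrary filter covers [\oo], the image of a subsequence and an ultrafilter at once; working
    by coordinates reduces limits to real ones. *)
Definition vlim n (u : T -> 'cV[R]_n) (a : 'cV[R]_n) :=
  forall i, u t i 0 @[t --> F] --> a i 0.

Lemma cvg_bigsum (I : Type) (r : seq I) (P : pred I) (f : I -> T -> R) (a : I -> R) :
  (forall i, P i -> f i t @[t --> F] --> a i) ->
  \sum_(i <- r | P i) f i t @[t --> F] --> \sum_(i <- r | P i) a i.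
Proof. by move=> fa; apply: cvg_big => //; exact: add_continuous. Qed.

Lemma vlim_add n (u v : T -> 'cV[R]_n) a b :
  vlim u a -> vlim v b -> vlim (fun t => u t + v t) (a + b).
Proof.
by move=> ua vb i; under eq_fun do rewrite mxE; rewrite mxE; exact: cvgD.
Qed.

Lemma vlim_scale n (k : R) (u : T -> 'cV[R]_n) a :
  vlim u a -> vlim (fun t => k *: u t) (k *: a).
Proof.
move=> ua i; under eq_fun do rewrite mxE; rewrite mxE.
by apply: cvgM => //; exact: cvg_cst.
Qed.

Lemma vlim_opp n (u : T -> 'cV[R]_n) a : vlim u a -> vlim (fun t => - u t) (- a).
Proof.
by move=> ua i; under eq_fun do rewrite mxE; rewrite mxE; exact: cvgN.
Qed.

Lemma vlim_cst n (a : 'cV[R]_n) : vlim (fun=> a) a.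
Proof. by move=> i; exact: cvg_cst. Qed.

Lemma vlim_mulmx m n (A : 'M[R]_(m, n)) (u : T -> 'cV[R]_n) a :
  vlim u a -> vlim (fun t => A *m u t) (A *m a).
Proof.
move=> ua i; under eq_fun do rewrite mxE; rewrite mxE.
by apply: cvg_bigsum => j _; apply: cvgM => //; exact: cvg_cst.
Qed.

Lemma vlim_sqnorm n (u : T -> 'cV[R]_n) a :
  vlim u a -> sqnorm (u t) @[t --> F] --> sqnorm a.
Proof.
move=> ua; apply: cvg_bigsum => i _; rewrite expr2.
by under eq_fun do rewrite expr2; exact: cvgM.
Qed.

Lemma vlim_unique n (u : T -> 'cV[R]_n) a b : vlim u a -> vlim u b -> a = b.
Proof.
move=> ua ub; apply/matrixP => i j; rewrite (ord1 j).
exact: (cvg_unique _ (ua i) (ub i)).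
Qed.

End CoordinatewiseLimits.
Arguments vlim {R T} F {n} u a.
Arguments vlim_scale {R T F FF n} k {u a}.
Arguments vlim_mulmx {R T F FF m n} A {u a}.
Arguments vlim_cst {R T F FF n} a.

Lemma vlim_finer {R : realType} {T : Type} (F G : set_system T) n
  (u : T -> 'cV[R]_n) a : F `<=` G -> vlim F u a -> vlim G u a.
Proof. by move=> FG ua i A /(ua i); exact: FG. Qed.

Lemma vlim_of_sqnorm {R : realType} n (u : nat -> 'cV[R]_n) :
  sqnorm (u j) @[j --> \oo] --> (0 : R) -> vlim \oo u 0.
Proof.
move=> u0 i; rewrite mxE; apply/cvgrPdist_lt => e e0.
move/cvgrPdist_lt : u0 => /(_ (e ^+ 2)); rewrite exprn_gt0// => /(_ isT).
apply: filterS => j; rewrite !sub0r !normrN ger0_norm ?sqnorm_ge0// => je.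
apply: (le_lt_trans (coord_le_norm2 _ _) _).
by rewrite -(@ltr_pXn2r _ 2)// ?nnegrE ?norm2_ge0 ?(ltW e0)// norm2_sq.
Qed.

(** Storing the subsequence as the filter [phi @ \oo] on the original indices lets [xs j] and
    [xs j.+1] be compared along the same filter. *)
Lemma vlim_of_vcvg {R : realType} n (phi : nat -> nat) (u : nat -> 'cV[R]_n) a :
  vcvg (fun k => u (phi k)) a -> vlim (phi @ \oo) u a.
Proof.
move=> ua i; apply/cvgrPdist_lt => e e0; have [N hN] := ua e e0.
exists N => // k /= /hN; apply: le_lt_trans.
by rewrite distrC; have := coord_le_norm2 (u (phi k) - a) i; rewrite !mxE.
Qed.

(** The image of an ultrafilter is an ultrafilter, and it contains the compact segment from [- M] to
    [M]. *)
Lemma ultra_cvg {R : realType} {T : Type} (F : set_system T) (f : T -> R) (M : R) :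
  UltraFilter F -> (forall t, `|f t| <= M) -> exists a : R, f @ F --> a.
Proof.
move=> FU fM; have := @segment_compact R (- M) M.
rewrite compact_ultra => /(_ (f @ F)) [].
- split=> [|G GF FG]; first exact: fmap_proper_filter.
  rewrite predeqE => A; split=> [GA|]; last exact: FG.
  have [//|FnA] := in_ultra_setVsetC (f @^-1` A) FU.
  have /filter_ex[x []] : G (A `&` ~` A) by apply: filterI => //; exact: FG.
  by [].
- by apply: (@filterE T F) => t /=; rewrite in_itv/= -ler_norml.
- by move=> a [_ ?]; exists a.
Qed.

Lemma bounded_ultra_vlim {R : realType} n (F : set_system nat) (u : nat -> 'cV[R]_n) :
  UltraFilter F -> vbounded u -> exists a, vlim F u a.
Proof.
move=> FU [M uM].
have H i : exists b : R, u t i 0 @[t --> F] --> b.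
  by apply: (@ultra_cvg _ _ _ _ M) => // t; exact: (le_trans (coord_le_norm2 _ _) (uM t)).
have [b hb] := choice H.
by exists (\col_i b i) => i; rewrite mxE.
Qed.

(** * Smoothness and barrier estimates for the utility term *)

Section Utility.
Context {R : realType} {K P : nat} (blk : 'I_P -> 'I_K).
Variables (beta : R) (s : 'I_K -> R) (w : 'I_K -> nat).
Hypotheses (beta0 : 0 < beta) (s0 : forall k, 0 < s k).

(* The logarithmic part uses [1 - a / u <= ln (u / a) <= u / a - 1]; the
   rational part is an identity. *)
Lemma Uk_taylor k (a u : R) : 0 < a -> a / 2 <= u ->
  `|Uk beta s k u - Uk beta s k a - (beta / a + s k / a ^+ 2) * (u - a)|
  <= (2 * beta / a ^+ 2 + 2 * s k / a ^+ 3) * (u - a) ^+ 2.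
Proof.
move=> a0 au; have u0 : 0 < u by lra.
have ln_le (x y : R) : 0 < x -> 0 < y -> ln y - ln x <= y / x - 1.
  move=> x0 y0; rewrite -ln_div ?posrE//.
  have := @le_ln1Dx R (y / x - 1); rewrite addrCA subrr addr0; apply.
  by have := divr_gt0 y0 x0; lra.
have h1 := ln_le a u a0 u0.
have h2 := ln_le u a u0 a0.
set D := (u - a) ^+ 2; have D0 : 0 <= D by exact: sqr_ge0.
(* The condition [a / 2 <= u] trades [u^-1] for a constant depending on [a] only. *)
have uI : u^-1 <= 2 / a.
  by rewrite -[2 / a]invf_div lef_pV2 ?posrE ?divr_gt0//.
have lnub : ln u - ln a - (u - a) / a <= 0.
  have -> : (u - a) / a = u / a - 1 by field; rewrite gt_eqF.
  by lra.
have lnlb : - (D / (u * a)) <= ln u - ln a - (u - a) / a.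
  have -> : - (D / (u * a)) = 1 - a / u - (u - a) / a.
    by rewrite /D; field; rewrite !gt_eqF.
  by lra.
have bD : D / (u * a) <= 2 / a ^+ 2 * D.
  rewrite mulrC; apply: ler_wpM2r => //; rewrite invfM.
  have -> : 2 / a ^+ 2 = 2 / a * a^-1 by field; rewrite gt_eqF.
  by rewrite ler_wpM2r// invr_ge0 ltW.
have sD : D / (u * a ^+ 2) <= 2 / a ^+ 3 * D.
  rewrite mulrC; apply: ler_wpM2r => //; rewrite invfM.
  have -> : 2 / a ^+ 3 = 2 / a * (a ^+ 2)^-1 by field; rewrite gt_eqF.
  by rewrite ler_wpM2r// invr_ge0 sqr_ge0.
have -> : Uk beta s k u - Uk beta s k a - (beta / a + s k / a ^+ 2) * (u - a)
  = beta * (ln u - ln a - (u - a) / a) - s k * (D / (u * a ^+ 2)).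
  by rewrite /Uk /D; field; rewrite !gt_eqF.
have Ds0 : 0 <= D / (u * a ^+ 2).
  by rewrite divr_ge0// mulr_ge0 ?sqr_ge0// ltW.
have -> : (2 * beta / a ^+ 2 + 2 * s k / a ^+ 3) * D =
  beta * (2 / a ^+ 2 * D) + s k * (2 / a ^+ 3 * D) by ring.
have b1 := ler_wpM2l (ltW (s0 k)) sD.
have b2 := mulr_ge0 (ltW (s0 k)) Ds0.
have b3 : - (2 / a ^+ 2 * D) <= ln u - ln a - (u - a) / a by lra.
have b4 := ler_wpM2l (ltW beta0) b3.
have b5 := ler_wpM2l (ltW beta0) lnub.
have b6 := mulr_ge0 (ltW beta0) (le_trans Ds0 sD).
by rewrite ler_norml; apply/andP; split; lra.
Qed.

(** The barrier [s k / u] is kept in the bound: it is what later keeps block sums away from 0. *)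
Lemma neg_Uk_ge k (M u : R) : 0 < u -> u <= M ->
  - (beta * ln M) + s k / u <= - Uk beta s k u.
Proof.
move=> u0 uM; rewrite /Uk opprB addrC lerD2l lerN2 ler_wpM2l ?(ltW beta0)//.
by rewrite ler_ln ?posrE// (lt_le_trans u0).
Qed.

Lemma bsum_cvg {T : Type} {F : set_system T} {FF : ProperFilter F}
  (x : T -> 'cV[R]_P) xb k : vlim F x xb ->
  bsum blk (x t) k @[t --> F] --> bsum blk xb k.
Proof. by move=> xxb; apply: cvg_bigsum => i _; exact: xxb. Qed.

Lemma fsmooth_cvg {T : Type} {F : set_system T} {FF : ProperFilter F}
  (x : T -> 'cV[R]_P) xb : vlim F x xb -> (forall k, 0 < bsum blk xb k) ->
  fsmooth blk beta s (x t) @[t --> F] --> fsmooth blk beta s xb.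
Proof.
move=> xxb xb0; apply: cvgN; apply: cvg_bigsum => k _.
have bk : bsum blk (x t) k @[t --> F] --> bsum blk xb k by exact: bsum_cvg.
apply: cvgB.
  apply: cvgM; first exact: cvg_cst.
  exact: (continuous_cvg _ (continuous_ln (xb0 k)) bk).
apply: cvgM; first exact: cvg_cst.
by apply: cvgV bk; rewrite gt_eqF.
Qed.

Lemma bnorm1E (x : 'cV[R]_P) k : inX blk w x -> bnorm1 blk x k = bsum blk x k.
Proof. by move=> /andP[/forallP x0 _]; apply: eq_bigr => i _; rewrite ger0_norm. Qed.

Lemma fobjE (x : 'cV[R]_P) : inX blk w x -> (forall k, 0 < bnorm1 blk x k) ->
  fobj blk beta s x = (fsmooth blk beta s x)%:E.
Proof.
move=> xX xp; rewrite /fobj /fsmooth; case: ifPn => [_|/forallPn[k]]; last by rewrite xp.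
by congr (- _)%:E; apply: eq_bigr => k _; rewrite bnorm1E.
Qed.

Lemma bsum_dist (u x : 'cV[R]_P) k :
  `|bsum blk u k - bsum blk x k| <= P%:R * norm2 (u - x).
Proof.
rewrite /bsum -sumrB; apply: (le_trans (ler_norm_sum _ _ _)).
have -> : P%:R * norm2 (u - x) = \sum_(i < P) norm2 (u - x).
  by rewrite sumr_const card_ord mulr_natl.
rewrite [leRHS](bigID (fun i => blk i == k))/=.
apply: ler_wpDr; first by apply: sumr_ge0 => i _; exact: norm2_ge0.
by apply: ler_sum => i _; have := coord_le_norm2 (u - x) i; rewrite !mxE.
Qed.

(** Entry [i] is minus the derivative of [Uk] at the sum of the block of [i], hence constant on each
    block. *)
Definition fsmooth_grad (x : 'cV[R]_P) : 'cV[R]_P :=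
  \col_i - (beta / bsum blk x (blk i) + s (blk i) / bsum blk x (blk i) ^+ 2).

Lemma inner_fsmooth_grad x v : inner (fsmooth_grad x) v =
  - \sum_k (beta / bsum blk x k + s k / bsum blk x k ^+ 2) * bsum blk v k.
Proof.
rewrite /inner (partition_big blk predT)//= -sumrN; apply: eq_bigr => k _.
rewrite mulr_sumr -sumrN; apply: eq_bigr => i /eqP <-.
by rewrite mxE mulNr.
Qed.

(** [Uk_taylor] is applied in each block. Positivity of nearby block sums is returned as well, so
    that nearby points of [inX] are admissible competitors for [limit_x_optimal]. *)
Lemma fsmooth_taylor (x : 'cV[R]_P) : (forall k, 0 < bsum blk x k) ->
  exists C d : R, [/\ 0 < C, 0 < d & forall u, norm2 (u - x) < d ->
   (forall k, 0 < bsum blk u k) /\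
   `|fsmooth blk beta s u - fsmooth blk beta s x - inner (fsmooth_grad x) (u - x)|
     <= C * norm2 (u - x) ^+ 2].
Proof.
move=> xp.
pose a k := bsum blk x k.
pose Ck k := 2 * beta / a k ^+ 2 + 2 * s k / a k ^+ 3.
have Ck0 k : 0 <= Ck k.
  have a0 := ltW (xp k); have b0' := ltW beta0; have sk := ltW (s0 k).
  by rewrite addr_ge0// divr_ge0 ?exprn_ge0// mulr_ge0.
pose C := \sum_k Ck k * P%:R ^+ 2 + 1.
have C0 : 0 < C.
  by rewrite ltr_wpDl// sumr_ge0// => k _; rewrite mulr_ge0// sqr_ge0.
(* Within this radius [bsum_dist] moves each block sum by less than [a k / 2], the range of
   [Uk_taylor]; the [+ 1] keeps the denominator positive. *)
pose d := \big[Num.min/1]_k (a k / (2 * (P%:R + 1))).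
have P1 : 0 < P%:R + 1 :> R by rewrite ltr_wpDl.
have d0 : 0 < d.
  by apply: lt_bigmin => // k _; rewrite divr_gt0 ?mulr_gt0// xp.
exists C, d; split => // u ud.
have near k : `|bsum blk u k - a k| < a k / 2.
  apply: (le_lt_trans (bsum_dist u x k)).
  have dk : norm2 (u - x) < a k / (2 * (P%:R + 1)).
    by apply: (lt_le_trans ud); exact: bigmin_le_cond.
  have -> : a k / 2 = (P%:R + 1) * (a k / (2 * (P%:R + 1))).
    by field; rewrite gt_eqF.
  apply: (@le_lt_trans _ _ ((P%:R + 1) * norm2 (u - x))).
    by rewrite ler_wpM2r ?norm2_ge0// lerDl.
  by rewrite ltr_pM2l.
have ua k : a k / 2 <= bsum blk u k.
  by have := near k; rewrite ltr_norml => /andP[]; rewrite /a; lra.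
split=> [k|]; first by apply: lt_le_trans (ua k); rewrite divr_gt0// xp.
have -> : fsmooth blk beta s u - fsmooth blk beta s x - inner (fsmooth_grad x) (u - x)
  = - \sum_k (Uk beta s k (bsum blk u k) - Uk beta s k (a k)
     - (beta / a k + s k / a k ^+ 2) * (bsum blk u k - a k)).
  rewrite inner_fsmooth_grad /fsmooth !sumrB.
  have e k : bsum blk (u - x) k = bsum blk u k - a k.
    by rewrite /a /bsum -sumrB; apply: eq_bigr => i _; rewrite !mxE.
  under [X in _ - - X]eq_bigr do rewrite e.
  by rewrite /a; ring.
rewrite normrN; apply: (le_trans (ler_norm_sum _ _ _)).
rewrite mulrDl mul1r ler_wpDr ?sqr_ge0// mulr_suml.
apply: ler_sum => k _.
have h := @Uk_taylor k (a k) (bsum blk u k) (xp k) (ua k).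
apply: (le_trans h).
rewrite -/(Ck k) -[leRHS]mulrA; apply: ler_wpM2l => //.
rewrite -exprMn -real_normK ?num_real//; apply: lerXn2r; rewrite ?nnegrE//.
  by rewrite mulr_ge0 ?norm2_ge0.
exact: bsum_dist.
Qed.

(** Turns quadratic remainders into the first-order form demanded by gradients and Frechet
    normals. *)
Lemma quadratic_small (C d e : R) : 0 < C -> 0 < d -> 0 < e ->
  exists d', [/\ 0 < d', d' <= d & forall t, 0 <= t -> t < d' -> C * t ^+ 2 <= e * t].
Proof.
move=> C0 d0 e0; exists (Num.min d (e / C)); split.
- by rewrite lt_min d0 divr_gt0.
- by rewrite ge_min lexx.
move=> t t0; rewrite lt_min => /andP[_ te].
by rewrite expr2 mulrA ler_wpM2r// -ler_pdivlMl// mulrC ltW.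
Qed.

Lemma fsmooth_is_gradient (x : 'cV[R]_P) : (forall k, 0 < bsum blk x k) ->
  is_gradient (fsmooth blk beta s) x (fsmooth_grad x).
Proof.
move=> /fsmooth_taylor[C [d [C0 d0 H]]] e e0.
have [d' [d'0 d'd hd']] := quadratic_small C0 d0 e0.
exists d'; split => // u ud; have [_ Hu] := H u (lt_le_trans ud d'd).
by apply: (le_trans Hu); rewrite hd'// norm2_ge0.
Qed.

Lemma fsmooth_lower_bound (M : R) : exists B : R, forall (x : 'cV[R]_P) k,
  (forall k', 0 < bsum blk x k') -> (forall k', bsum blk x k' <= M) ->
  B + s k / bsum blk x k <= fsmooth blk beta s x.
Proof.
exists (\sum_(k < K) - (beta * ln M)) => x k xp xM.
have h k' := neg_Uk_ge k' (xp k') (xM k').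
(* Only the barrier of block [k] is kept; those of the other blocks are nonnegative and dropped. *)
rewrite -lerBrDl /fsmooth -sumrN -sumrB (bigD1 k)//=; apply: ler_wpDr.
  apply: sumr_ge0 => k' _; rewrite subr_ge0; apply: le_trans (h k').
  by rewrite lerDl divr_ge0// ltW.
by rewrite lerBrDl.
Qed.

End Utility.

(** * Explicit multipliers for the maximal ratio over the box *)

Section MaxOverBox.
Context {R : realType} {L : nat}.

(* [m] maximises [\sum_l u l * v l - max v] over the unit cube: fixing the
   maximum [M] forces [m l = M] where [u l > 0] and [m l = 0] where [u l < 0], so
   the value is [M * (T - 1)] with [T] the sum of the positive parts. *)
Lemma cube_max_multiplier (m u : 'I_L -> R) (M : R) :
  (forall l, 0 <= m l <= 1) -> (forall l, m l <= M) -> (exists l, m l = M) ->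
  (forall (v : 'I_L -> R) N, (forall l, 0 <= v l <= 1) -> (forall l, v l <= N) ->
     (exists l, v l = N) ->
     \sum_l u l * v l - N <= \sum_l u l * m l - M) ->
  exists lam : 'I_L -> R, [/\ forall l, 0 <= lam l, \sum_l lam l = 1,
    forall l, lam l != 0 -> m l = M,
    forall l, 0 < m l -> lam l <= u l & forall l, m l < 1 -> u l <= lam l].
Proof.
move=> m01 mM [l0 ml0] opt.
have M0 : 0 <= M by rewrite -ml0; case/andP: (m01 l0).
have M1 : M <= 1 by rewrite -ml0; case/andP: (m01 l0).
(* The maximum of such a [v] is at most [M], so among these points [m] maximises the linear part
   alone. *)
have optM (v : 'I_L -> R) : (forall l, 0 <= v l <= M) ->
    \sum_l u l * v l <= \sum_l u l * m l.
  move=> v0M.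
  pose l1 := [arg max_(l > l0) v l]%O.
  have vl1 l : v l <= v l1 by rewrite /l1; case: arg_maxP => // i _; apply.
  have := @opt v (v l1) _ vl1 (ex_intro _ l1 erefl).
  have /andP[_ vM] := v0M l1.
  suff H : forall l, 0 <= v l <= 1 by move=> /(_ H); lra.
  by move=> l; case/andP: (v0M l) => -> /le_trans ->.
(* The linear problem separates: one coordinate is changed at a time. *)
have swap l t : 0 <= t <= M -> u l * t <= u l * m l.
  move=> t0M; pose v i := if i == l then t else m i.
  have vM i : 0 <= v i <= M.
    by rewrite /v; case: eqP => // _; rewrite mM andbT; case/andP: (m01 i).
  have := optM v vM; rewrite (bigD1 l)//= [leRHS](bigD1 l)//= /v eqxx.
  rewrite (eq_bigr (fun i => u i * m i)) => [|i /negPf ->//].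
  by rewrite lerD2r.
pose p l := Num.max (u l) 0.
have p0 l : 0 <= p l by rewrite /p le_max lexx orbT.
have um l : u l * m l = M * p l.
  have /andP[ml _] := m01 l; have mlM := mM l.
  rewrite /p maxEle; case: ifPn => [ul|]; last rewrite -ltNge => ul.
    apply/eqP; rewrite mulr0 eq_le mulr_le0_ge0//=.
    by have := swap l 0; rewrite lexx M0 mulr0 => ->.
  apply/eqP; rewrite mulrC eq_le ler_wpM2r ?(ltW ul)//=.
  by rewrite mulrC [leRHS]mulrC swap// lexx M0.
have A l : 0 < u l -> m l = M.
  move=> ul; have := um l; rewrite /p maxEle leNgt ul/= mulrC.
  by move/(mulIf (lt0r_neq0 ul)).
pose T := \sum_l p l.
have val : \sum_l u l * m l = M * T.
  by rewrite mulr_sumr; apply: eq_bigr => l _; exact: um.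
(* The competitor is the indicator of [0 < u l], of value [T - 1]; if no such index exists, [T = 0]
   and the claim reads [M <= 1]. *)
have optT : T - 1 <= M * T - M.
  have [[l1 ul1]|none] := pselect (exists l, 0 < u l); last first.
    have -> : T = 0.
      apply: big1 => l _; rewrite /p max_r// leNgt; apply/negP => ul.
      by apply: none; exists l.
    by rewrite mulr0 !sub0r lerN2.
  have := @opt (fun l => if 0 < u l then 1 else 0) 1.
  rewrite val => H; apply: le_trans (H _ _ _) => [|l|l|]; last 1 first.
  - by exists l1; rewrite ul1.
  - rewrite lerD2r /T; apply: ler_sum => l _; rewrite /p maxEle.
    by case: leP => _; rewrite (mulr1, mulr0).
  - by case: ifP; rewrite ?lexx ler01.
  - by case: ifP; rewrite ?ler01.
have opt0 : 0 <= M * T - M.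
  have := @opt (fun=> 0) 0; rewrite big1 ?subr0 ?val; last by move=> l _; rewrite mulr0.
  apply => [l|l|]; [by rewrite lexx ler01|exact: lexx|by exists l0].
(* [optT] and [opt0] say that [(1 - M) * (T - 1) <= 0 <= M * (T - 1)]. For [1 <= T] the normalised
   positive parts work: if some [m l < 1] has [0 < u l], then [M < 1] and [T = 1]. *)
have [T1|T1] := leP 1 T.
  have T0 : 0 < T by lra.
  exists (fun l => p l / T); split=> [l|||l ml|l ml].
  - by rewrite divr_ge0// ltW.
  - by rewrite -mulr_suml divff// gt_eqF.
  - move=> l; apply: contra_neq_eq => mlM.
    rewrite /p max_r ?mul0r// leNgt; apply: contra mlM => /A ->; exact: eqxx.
  - have ul : 0 <= u l.
      rewrite leNgt; apply/negP => ul; have := um l.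
      rewrite /p max_r ?(ltW ul)// mulr0 => /eqP; rewrite mulf_eq0.
      by rewrite (gt_eqF ml) (lt_eqF ul).
    by rewrite /p max_l// ler_pdivrMr// ler_peMr.
  - have [ul|ul] := ltP 0 (u l); last first.
      by apply: (le_trans ul); rewrite divr_ge0// ltW.
    have mlM := A l ul.
    have TT : T = 1.
      by apply/eqP; rewrite eq_le T1 andbT; rewrite mlM in ml; nra.
    by rewrite TT divr1 /p max_l// ltW.
(* Here [T < 1] forces [M = 0], so every [m l] equals [M] and the missing mass [1 - T] may sit at
   any index. *)
have M00 : M = 0.
  apply/eqP; rewrite eq_le M0 andbT leNgt; apply/negP => Mp.
  by have := ltr_pM2l Mp T 1; rewrite T1 mulr1 ltNge -subr_ge0 opt0.
exists (fun l => p l + (if l == l0 then 1 - T else 0)); split=> [l||l _|l|l _].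
- by rewrite addr_ge0//; case: ifP => // _; lra.
- rewrite big_split/= -/T (bigD1 l0)//= eqxx big1 => [|i /negPf ->//].
  by rewrite addr0 addrC subrK.
- by apply/eqP; rewrite eq_le mM M00; case/andP: (m01 l).
- by have := mM l; rewrite M00 ltNge => ->.
- rewrite ler_wpDr//; last by rewrite /p le_max lexx.
  by case: ifP => // _; lra.
Qed.

Variables (c : 'cV[R]_L) (alpha : R).
Hypotheses (c0 : forall l, 0 < c l 0) (alpha0 : 0 < alpha).

(** Domination and attainment characterise the maximum as a real number, so later arguments avoid
    the extended-real maximum seeded at [-oo]. *)
Definition is_max_ratio (G : 'cV[R]_L -> R) :=
  (forall (y : 'cV[R]_L) l, y l 0 / c l 0 <= G y) /\
  (forall y : 'cV[R]_L, exists l, G y = y l 0 / c l 0).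

Lemma gobj_max_ratio : (0 < L)%N ->
  exists2 G, is_max_ratio G & forall y, gobj alpha c y = (alpha * G y)%:E.
Proof.
move=> L0; pose l0 := Ordinal L0.
have H (y : 'cV[R]_L) : exists g : R, [/\ forall l, y l 0 / c l 0 <= g,
    exists l, g = y l 0 / c l 0 & gobj alpha c y = (alpha * g)%:E].
  have [l _ El] := @eq_bigmax _ _ 'I_L -oo%E l0 predT
    (fun l => (y l 0 / c l 0)%:E) isT (fun l _ => leNye _).
  exists (y l 0 / c l 0); split; [|by exists l|by rewrite /gobj El].
  move=> i; rewrite -lee_fin -[leRHS]El.
  exact: (@bigmax_sup _ _ _ _ i).
have [G HG] := choice H.
exists G; last by move=> y; have [] := HG y.
by split=> y; have [] := HG y.
Qed.

Lemma max_ratio_convex G (y u : 'cV[R]_L) t : is_max_ratio G -> 0 <= t <= 1 ->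
  G (y + t *: (u - y)) <= (1 - t) * G y + t * G u.
Proof.
move=> [Gge Gex] /andP[t0 t1]; have [l ->] := Gex (y + t *: (u - y)).
rewrite !mxE.
have -> : (y l 0 + t * (u l 0 - y l 0)) / c l 0 =
  (1 - t) * (y l 0 / c l 0) + t * (u l 0 / c l 0) by ring.
by apply: lerD; apply: ler_wpM2l => //; rewrite subr_ge0.
Qed.

Lemma inY_convex (y u : 'cV[R]_L) t : inY c y -> inY c u -> 0 <= t <= 1 ->
  inY c (y + t *: (u - y)).
Proof.
move=> /forallP yY /forallP uY /andP[t0 t1]; apply/forallP => l.
have /andP[y0 yc] := yY l; have /andP[u0 uc] := uY l; rewrite !mxE.
by apply/andP; split; nra.
Qed.

(** Dividing [y l] by [c l] maps the box to the unit cube, and dividing the objective by [- alpha]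
    gives the maximisation of [cube_max_multiplier]. *)
Lemma box_max_multiplier G (yb zh : 'cV[R]_L) : is_max_ratio G -> inY c yb ->
  (forall y, inY c y -> alpha * G yb + inner zh yb <= alpha * G y + inner zh y) ->
  exists gg nY : 'cV[R]_L,
    [/\ forall u, alpha * G yb + inner gg (u - yb) <= alpha * G u,
        forall u, inY c u -> inner nY (u - yb) <= 0 & gg + nY + zh = 0].
Proof.
move=> [Gge Gex] /forallP ybY opt.
pose m l := yb l 0 / c l 0; pose u l := - (zh l 0 * c l 0) / alpha.
have cn0 l : c l 0 != 0 by rewrite gt_eqF.
have an0 : alpha != 0 by rewrite gt_eqF.
have innerE (y : 'cV[R]_L) : inner zh y = - alpha * \sum_l u l * (y l 0 / c l 0).
  rewrite mulr_sumr; apply: eq_bigr => l _; rewrite /u; field.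
  by rewrite an0 cn0.
have [lb Gyb] := Gex yb.
have [||||lam [lam0 lam1 lamM lamle lamge]] := @cube_max_multiplier m u (G yb).
- move=> l; have /andP[y0 yc] := ybY l.
  by rewrite /m divr_ge0 ?(ltW (c0 _))//= ler_pdivrMr// mul1r.
- by move=> l; exact: Gge.
- by exists lb.
- move=> v N v01 vN [l1 vl1].
  pose y : 'cV[R]_L := \col_l (v l * c l 0).
  have yv l : y l 0 / c l 0 = v l by rewrite mxE mulfK.
  have GyN : G y = N.
    have [l Gl] := Gex y; apply/eqP; rewrite eq_le Gl yv vN/= -vl1.
    by have := Gge y l1; rewrite Gl !yv.
  have yY : inY c y.
    apply/forallP => l; rewrite mxE; have /andP[v0 v1] := v01 l.
    by rewrite mulr_ge0 ?(ltW (c0 _))//= ler_piMl// ltW.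
  have := opt y yY; rewrite !innerE GyN.
  under [X in _ <= _ + _ * X]eq_bigr do rewrite yv.
  by rewrite -/(m _); move=> H; rewrite -(ler_pM2l alpha0); lra.
(* A convex combination of the gradients of [alpha * y l / c l] over the ratios active at [yb]; the
   normal is whatever remains. *)
pose gg : 'cV[R]_L := \col_l (alpha * lam l / c l 0).
exists gg, (- zh - gg); split; last by rewrite [- zh - gg]addrC addrA subrr add0r addNr.
- move=> v; rewrite -lerBrDl -mulrBr.
  have -> : inner gg (v - yb) = alpha * \sum_l lam l * (v l 0 / c l 0 - m l).
    rewrite mulr_sumr; apply: eq_bigr => l _; rewrite !mxE /m; field.
    by rewrite cn0.
  rewrite ler_pM2l// -[leRHS]mul1r -lam1 mulr_suml; apply: ler_sum => l _.
  have [->|ll] := eqVneq (lam l) 0; first by rewrite !mul0r.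
  by rewrite (lamM l ll) ler_wpM2l// lerD2r.
- move=> v /forallP vY; apply: sumr_le0 => l _; rewrite !mxE.
  have -> : - zh l 0 - alpha * lam l / c l 0 = alpha / c l 0 * (u l - lam l).
    by rewrite /u; field; rewrite an0 cn0.
  rewrite -mulrA pmulr_rle0 ?divr_gt0//.
  have /andP[v0 vc] := vY l; have /andP[y0 yc] := ybY l.
  (* A coordinate can decrease only where [0 < m l] and increase only where [m l < 1], which is
     where [lamle] and [lamge] give the sign. *)
  have [dv|dv] := leP (v l 0) (yb l 0).
    have [ev|ne] := eqVneq (v l 0) (yb l 0); first by rewrite ev subrr mulr0.
    apply: mulr_ge0_le0; last by rewrite subr_le0.
    rewrite subr_ge0 lamle// /m divr_gt0// (le_lt_trans v0)//.
    by rewrite lt_neqAle ne.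
  apply: mulr_le0_ge0; last by rewrite subr_ge0 ltW.
  rewrite subr_le0 lamge//.
  by rewrite /m ltr_pdivrMr// mul1r (lt_le_trans dv).
Qed.

End MaxOverBox.

(** * Limiting subgradients from Frechet inequalities *)

Section Subgradients.
Context {R : realType} {n : nat}.

Lemma frechet_limiting (h : 'cV[R]_n -> \bar R) x v :
  frechet_subgrad h x v -> limiting_subgrad h x v.
Proof.
move=> hxv; split; first by case: hxv.
have cst (a : 'cV[R]_n) : vcvg (fun=> a) a.
  move=> e e0; exists 0%N => k _.
  by rewrite subrr -(scale0r (0 : 'cV[R]_n)) norm2Z normr0 mul0r.
exists (fun=> x), (fun=> v); split=> //; split=> //; split=> // e e0.
by exists 0%N => k _; rewrite subrr normr0.
Qed.

(** Off [S] the indicator is [+oo], so only points of [S] need testing; no convexity of [S]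
    enters. *)
Lemma eindic_subgrad (S : pred 'cV[R]_n) x v : S x ->
  (forall e, 0 < e -> exists d, 0 < d /\ forall u, S u -> norm2 (u - x) < d ->
     inner v (u - x) <= e * norm2 (u - x)) ->
  limiting_subgrad (eindic S) x v.
Proof.
move=> Sx H; apply: frechet_limiting; rewrite /frechet_subgrad /eindic Sx.
split=> // e e0; have [d [d0 Hd]] := H e e0; exists d; split=> // u ud.
by case: ifPn => [Su|_]; rewrite ?leey// lee_fin add0r subr_le0 Hd.
Qed.

End Subgradients.

(** * Scalar descent and a first-order test *)

Section Descent.
Context {R : realType}.

Lemma cvg0_of_bounded_sums (d : nat -> R) (B : R) : (forall j, 0 <= d j) ->
  (forall n, \sum_(0 <= j < n) d j <= B) -> d j @[j --> \oo] --> (0 : R).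
Proof.
move=> d0 dB; apply: cvg_series_cvg_0; apply: nondecreasing_is_cvgn.
  apply/nondecreasing_seqP => n.
  by rewrite /series/= big_nat_recr//= lerDl.
by exists B => _ [n _ <-]; exact: dB.
Qed.

(** One telescoped inequality serves twice: the lower bound on [a] bounds the sums of [d], and
    discarding those sums bounds [a] above. *)
Lemma perturbed_descent (a d e : nat -> R) (kappa B S : R) : 0 < kappa ->
  (forall j, 0 <= d j) ->
  (forall j, a j.+1 <= a j - kappa * d j + e j) -> (forall j, B <= a j) ->
  (forall n, \sum_(0 <= j < n) e j <= S) ->
  (d j @[j --> \oo] --> (0 : R)) /\ forall j, a j <= a 0%N + S.
Proof.
move=> k0 d0 ad aB eS.
have tele n : a n + kappa * (\sum_(0 <= j < n) d j) <= a 0%N + \sum_(0 <= j < n) e j.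
  elim: n => [|n IH]; first by rewrite !big_nil mulr0 !addr0.
  rewrite !big_nat_recr//= mulrDr; have := ad n; lra.
have sd n : 0 <= \sum_(0 <= j < n) d j by apply: sumr_ge0.
split.
  apply: (@cvg0_of_bounded_sums _ ((a 0%N + S - B) / kappa)) => // n.
  by rewrite ler_pdivlMr// mulrC; have := tele n; have := eS n; have := aB n; lra.
move=> j; have := tele j; have := eS j.
by have := mulr_ge0 (ltW k0) (sd j); lra.
Qed.

Lemma ge0_of_quadratic (A B : R) : 0 <= B ->
  (forall t, 0 < t <= 1 -> 0 <= t * A + B * t ^+ 2) -> 0 <= A.
Proof.
move=> B0 H; rewrite leNgt; apply/negP => A0.
have BA : 0 < B - A by lra.
(* With this step [B * t <= - A / 2], so the linear term wins; the denominator stays positive even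
   for [B = 0]. *)
pose t := - A / (2 * (B - A)).
have t0 : 0 < t by rewrite divr_gt0//; lra.
have t1 : t <= 1 by rewrite ler_pdivrMr; lra.
have := H t; rewrite t0 t1 => /(_ isT).
have -> : t * A + B * t ^+ 2 = t * (A + B * t) by ring.
rewrite pmulr_rge0//.
have -> : A + B * t = A * ((B - 2 * A) / (2 * (B - A))).
  by rewrite /t; field; rewrite gt_eqF.
rewrite nmulr_rge0// leNgt divr_gt0//; lra.
Qed.

End Descent.

(** * Closedness of the constraint sets *)

Section ConstraintSets.
Context {R : realType} {T : Type} {F : set_system T} {FF : ProperFilter F}.

Lemma inX_closed K P (blk : 'I_P -> 'I_K) (w : 'I_K -> nat)
  (x : T -> 'cV[R]_P) xb :
  (forall t, inX blk w (x t)) -> vlim F x xb -> inX blk w xb.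
Proof.
move=> xX xxb; apply/andP; split; apply/forallP => i.
  apply: (cvgr_to_ge (xxb i)); apply: filterE => t.
  by have /andP[/forallP x0 _] := xX t.
(* Nonzero coordinates of the limit are eventually nonzero along [F], so the support of [xb] lies in
   that of some [x t]. *)
have nz : \forall t \near F, forall j, xb j 0 != 0 -> x t j 0 != 0.
  apply: filter_forall => j; have [xb0|xb0] := eqVneq (xb j 0) 0.
    exact: filterE.
  have e0 : 0 < `|xb j 0| by rewrite normr_gt0.
  have := xxb j; move/cvgrPdist_lt => /(_ _ e0).
  apply: filterS => t h _; apply: contraTneq h => ->.
  by rewrite subr0 ltxx.
have [t ht] := filter_ex nz.
have /andP[_ /forallP /(_ i)] := xX t; apply: leq_trans.
apply: subset_leq_card; apply/fintype.subsetP => j; rewrite !inE.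
by move=> /= /andP[-> /ht ->].
Qed.

Lemma inY_closed L (c : 'cV[R]_L) (y : T -> 'cV[R]_L) yb :
  (forall t, inY c (y t)) -> vlim F y yb -> inY c yb.
Proof.
move=> yY yyb; apply/forallP => l; apply/andP; split.
  by apply: (cvgr_to_ge (yyb l)); apply: filterE => t; have /forallP/(_ l)/andP[] := yY t.
by apply: (cvgr_to_le (yyb l)); apply: filterE => t; have /forallP/(_ l)/andP[] := yY t.
Qed.

End ConstraintSets.

(** * Descent and boundedness of the iterates *)

Section Algorithm.
Context {R : realType} {K L P : nat} (blk : 'I_P -> 'I_K).
Variables (Rm : 'M[R]_(L, P)) (c : 'cV[R]_L) (w : 'I_K -> nat).
Variables (alpha beta : R) (s : 'I_K -> R) (rho mu : R).
Variables (xs : nat -> 'cV[R]_P) (ys zs : nat -> 'cV[R]_L).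
Variable G : 'cV[R]_L -> R.
Hypotheses (K0 : (0 < K)%N) (Rm01 : forall l i, Rm l i = 0 \/ Rm l i = 1)
  (Rmcol : forall i, exists l, Rm l i != 0) (c0 : forall l, 0 < c l 0)
  (alpha0 : 0 < alpha) (beta0 : 0 < beta) (s0 : forall k, 0 < s k)
  (rho0 : 0 < rho) (rhomu : rho * specnorm Rm ^+ 2 < mu)
  (Gmax : is_max_ratio c G) (GE : forall y, gobj alpha c y = (alpha * G y)%:E).
Hypotheses (xs0X : inX blk w (xs 0%N)) (xs0p : forall k, 0 < bnorm1 blk (xs 0%N) k)
  (ys0Y : inY c (ys 0%N)).

Let nu j := xs j + (rho / mu) *: (Rm^T *m (ys j - Rm *m xs j + rho^-1 *: zs j)).

Hypothesis xstep : forall j, inX blk w (xs j.+1) /\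
  forall x, inX blk w x ->
    (fobj blk beta s (xs j.+1) + (mu / 2 * sqnorm (xs j.+1 - nu j))%:E
     <= fobj blk beta s x + (mu / 2 * sqnorm (x - nu j))%:E)%E.
Hypothesis ystep : forall j, inY c (ys j.+1) /\
  forall y, inY c y ->
    (gobj alpha c (ys j.+1)
       + (rho / 2 * sqnorm (ys j.+1 - Rm *m xs j.+1 + rho^-1 *: zs j))%:E
     <= gobj alpha c y
       + (rho / 2 * sqnorm (y - Rm *m xs j.+1 + rho^-1 *: zs j))%:E)%E.
Hypothesis zstep : forall j, zs j.+1 = zs j + rho *: (ys j.+1 - Rm *m xs j.+1).
Hypotheses (zsum : (\sum_(1 <= j <oo) (sqnorm (zs j.+1 - zs j))%:E < +oo)%E)
  (zbnd : vbounded zs).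

Let f := fsmooth blk beta s.

Let mu0 : 0 < mu.
Proof. by apply: le_lt_trans rhomu; rewrite mulr_ge0 ?sqr_ge0// ltW. Qed.

Lemma xs_inX j : inX blk w (xs j).
Proof. by case: j => // j; case: (xstep j). Qed.

Lemma ys_inY j : inY c (ys j).
Proof. by case: j => // j; case: (ystep j). Qed.

(** A vanishing block would make the objective [+oo], while the initial point is a competitor of
    finite value. *)
Lemma xs_pos j k : 0 < bnorm1 blk (xs j) k.
Proof.
case: j => [|j]; first exact: xs0p.
have [_ /(_ _ xs0X)] := xstep j.
rewrite (fobjE _ _ xs0X xs0p) {1}/fobj; case: ifPn => [/forallP //|_].
by rewrite -EFinD leye_eq.
Qed.

Lemma bsum_xs_pos j k : 0 < bsum blk (xs j) k.
Proof. by rewrite -(bnorm1E _ (xs_inX j)) xs_pos. Qed.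

Lemma x_optimal j x : inX blk w x -> (forall k, 0 < bnorm1 blk x k) ->
  f (xs j.+1) + mu / 2 * sqnorm (xs j.+1 - nu j) <= f x + mu / 2 * sqnorm (x - nu j).
Proof.
move=> xX xp; have [x1X /(_ _ xX)] := xstep j.
by rewrite (fobjE _ _ xX xp) (fobjE _ _ x1X (xs_pos j.+1)) -!EFinD lee_fin.
Qed.

Lemma y_optimal j y : inY c y ->
  alpha * G (ys j.+1) + rho / 2 * sqnorm (ys j.+1 - Rm *m xs j.+1 + rho^-1 *: zs j)
  <= alpha * G y + rho / 2 * sqnorm (y - Rm *m xs j.+1 + rho^-1 *: zs j).
Proof.
by move=> yY; have [_ /(_ _ yY)] := ystep j; rewrite !GE -!EFinD lee_fin.
Qed.

(* The augmented Lagrangian, with the multiplier term absorbed in the square. *)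
Definition lagr (x : 'cV[R]_P) (y z : 'cV[R]_L) :=
  f x + alpha * G y + rho / 2 * sqnorm (y - Rm *m x + rho^-1 *: z)
  - (2 * rho)^-1 * sqnorm z.

(** Adding the x-step and y-step inequalities cancels the cross terms [inner r (Rm *m d)], since [q]
    is [Rm^T *m r]; the spectral norm then controls [sqnorm (Rm *m d)]. *)
Lemma lagr_descent j :
  lagr (xs j.+1) (ys j.+1) (zs j.+1) <= lagr (xs j) (ys j) (zs j)
    - (mu - rho * specnorm Rm ^+ 2) / 2 * sqnorm (xs j.+1 - xs j)
    + rho^-1 * sqnorm (zs j.+1 - zs j).
Proof.
have hx := @x_optimal j _ (xs_inX j) (xs_pos j).
have hy := y_optimal j (ys_inY j).
have hR := sqnorm_mulmx_le Rm (xs j.+1 - xs j).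
move: hx hy hR; rewrite /nu /lagr zstep.
set x := xs j; set x1 := xs j.+1; set y := ys j; set y1 := ys j.+1; set z := zs j.
set r := y - Rm *m x + rho^-1 *: z; set q := Rm^T *m r.
set d := x1 - x; set r1 := y1 - Rm *m x1.
have -> : x1 - (x + (rho / mu) *: q) = d + (- (rho / mu)) *: q.
  by rewrite /d opprD addrA scaleNr.
have -> : x - (x + (rho / mu) *: q) = (- (rho / mu)) *: q.
  by rewrite opprD addrA subrr add0r scaleNr.
have -> : y - Rm *m x1 + rho^-1 *: z = r - Rm *m d.
  rewrite /r /d mulmxBr; move: (Rm *m x) (Rm *m x1) => a b.
  by apply/matrixP => i k; rewrite !mxE; ring.
rewrite sqnormD [sqnorm (r - _)]sqnormD sqnormN.
have -> : inner d (- (rho / mu) *: q) = - (rho / mu) * inner r (Rm *m d).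
  by rewrite innerC innerZl inner_trmx.
have -> : inner r (- (Rm *m d)) = - inner r (Rm *m d).
  by rewrite innerC innerNl innerC.
have -> : z + rho *: r1 - z = rho *: r1 by rewrite addrAC subrr add0r.
have -> : r1 + rho^-1 *: (z + rho *: r1) = r1 + rho^-1 *: z + r1.
  by rewrite scalerDr scalerA mulVf ?gt_eqF// scale1r addrA.
rewrite (sqnormD (r1 + rho^-1 *: z)) innerDl innerZl inner_sqnorm.
rewrite (sqnormD z) [inner z (rho *: _)]innerC innerZl [inner r1 z]innerC !sqnormZ.
set S := specnorm Rm ^+ 2; set p := sqnorm (r1 + _); set rd := inner r _.
move: (sqnorm d) (sqnorm q) (sqnorm (Rm *m d)) (sqnorm r) (sqnorm r1)
  (sqnorm z) (inner z r1) => sd sq sRd sr sr1 sz zr hx hy hR.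
have hR' := ler_wpM2l (ltW rho0) hR.
have e1 : mu / 2 * (sd + 2 * (- (rho / mu) * rd) + (- (rho / mu)) ^+ 2 * sq) =
  mu / 2 * sd - rho * rd + mu / 2 * ((- (rho / mu)) ^+ 2 * sq).
  by field; rewrite gt_eqF.
(* Passing from [z] to [z + rho *: r1] raises the Lagrangian by exactly [rho * sr1], which [e3]
   identifies with the error term. *)
have e2 : rho / 2 * (p + 2 * (sr1 + rho^-1 * zr) + sr1)
    - (2 * rho)^-1 * (sz + 2 * (rho * zr) + rho ^+ 2 * sr1) =
  rho / 2 * p + rho * sr1 - (2 * rho)^-1 * sz by field; rewrite gt_eqF.
have e3 : rho^-1 * (rho ^+ 2 * sr1) = rho * sr1 by field; rewrite gt_eqF.
rewrite e1 in hx; rewrite -[leLHS]addrA e2 e3.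
by lra.
Qed.

(* Every [x_i] is dominated by a coordinate of
   [R x^(j+1) = y^(j+1) - (z^(j+1) - z^j) / rho]. *)
Lemma xs_bounded : vbounded xs.
Proof.
have [Z zZ] := zbnd.
pose C := \sum_l c l 0 + rho^-1 * (2 * Z).
have bound j i : xs j.+1 i 0 <= C.
  have /andP[/forallP x0 _] := xs_inX j.+1.
  have [l Rl] := Rmcol i.
  have Rl1 : Rm l i = 1 by case: (Rm01 l i) => // E; rewrite E eqxx in Rl.
  have xR : xs j.+1 i 0 <= (Rm *m xs j.+1) l 0.
    rewrite mxE (bigD1 i)//= Rl1 mul1r lerDl; apply: sumr_ge0 => i' _.
    by rewrite mulr_ge0//; case: (Rm01 l i') => ->.
  have RE : (Rm *m xs j.+1) l 0 = ys j.+1 l 0 - rho^-1 * (zs j.+1 l 0 - zs j l 0).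
    by rewrite zstep !mxE; field; rewrite gt_eqF.
  have /forallP/(_ l)/andP[_ yc] := ys_inY j.+1.
  have cC : c l 0 <= \sum_l c l 0.
    by rewrite [leRHS](bigD1 l)//= lerDl sumr_ge0// => l' _; rewrite ltW.
  have z1 := le_trans (coord_le_norm2 (zs j.+1) l) (zZ j.+1).
  have z2 := le_trans (coord_le_norm2 (zs j) l) (zZ j).
  have zz : zs j l 0 - zs j.+1 l 0 <= 2 * Z.
    by move: z1 z2; rewrite !ler_norml => /andP[? ?] /andP[? ?]; lra.
  have rz : rho^-1 * (zs j l 0 - zs j.+1 l 0) <= rho^-1 * (2 * Z).
    by rewrite ler_pM2l// invr_gt0.
  by apply: (le_trans xR); rewrite RE /C; lra.
(* The multiplier update says nothing about the initial point, which is bounded separately. *)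
exists (Num.max (norm2 (xs 0%N)) (P%:R * C)) => -[|j]; rewrite le_max ?lexx//.
apply/orP; right; apply: (le_trans (norm2_le_sum _)).
have -> : P%:R * C = \sum_(i < P) C by rewrite sumr_const card_ord mulr_natl.
apply: ler_sum => i _; have /andP[/forallP x0 _] := xs_inX j.+1.
by rewrite ger0_norm.
Qed.

Lemma ys_bounded : vbounded ys.
Proof.
exists (\sum_l c l 0) => j; apply: (le_trans (norm2_le_sum _)).
by apply: ler_sum => l _; have /forallP/(_ l)/andP[y0 yc] := ys_inY j; rewrite ger0_norm.
Qed.

Lemma f_lower_bound : exists B, forall j k, B + s k / bsum blk (xs j) k <= f (xs j).
Proof.
have [M xM] := xs_bounded.
have [B HB] := fsmooth_lower_bound blk beta0 s0 (P%:R * M).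
exists B => j k; apply: HB => k'; first exact: bsum_xs_pos.
have -> : bsum blk (xs j) k' = bsum blk (xs j) k' - bsum blk (0 : 'cV[R]_P) k'.
  by rewrite {3}/bsum big1 ?subr0// => i _; rewrite mxE.
apply: le_trans (ler_norm _) _; apply: (le_trans (bsum_dist _ _ _ _)).
by rewrite subr0 ler_wpM2l.
Qed.

Lemma zsum_bounded : exists S, forall n,
  \sum_(0 <= j < n) sqnorm (zs j.+1 - zs j) <= S.
Proof.
have [S0 HS] : exists S : R,
    (\sum_(1 <= j <oo) (sqnorm (zs j.+1 - zs j))%:E <= S%:E)%E.
  move: zsum; case: (X in (X < _)%E) => // [r _|_]; first by exists r.
  by exists 0; exact: leNye.
(* The assumed series starts at index 1, so the first increment is added by hand. *)
exists (sqnorm (zs 1%N - zs 0%N) + S0) => -[|n].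
  rewrite big_nil addr_ge0 ?sqnorm_ge0// -lee_fin; apply: le_trans HS.
  by apply: nneseries_ge0 => j _ _; rewrite lee_fin sqnorm_ge0.
rewrite big_nat_recl// lerD2l.
have -> : \sum_(0 <= i < n) sqnorm (zs i.+2 - zs i.+1) =
    \sum_(1 <= i < n.+1) sqnorm (zs i.+1 - zs i) by rewrite big_add1.
rewrite -lee_fin -sumEFin; apply: le_trans HS.
by apply: nneseries_lim_ge => j _ _; rewrite lee_fin sqnorm_ge0.
Qed.

Lemma G_ge0 y : inY c y -> 0 <= G y.
Proof.
move=> /forallP yY; have [_ /(_ y)[l ->]] := Gmax.
by have /andP[y0 _] := yY l; rewrite divr_ge0// ltW.
Qed.

Lemma dz_to0 : vlim \oo (fun j => zs j.+1 - zs j) 0.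
Proof.
have [S HS] := zsum_bounded.
by apply: vlim_of_sqnorm; apply: cvg0_of_bounded_sums HS => j; exact: sqnorm_ge0.
Qed.

Lemma descent_consequences :
  vlim \oo (fun j => xs j.+1 - xs j) 0 /\ exists F1, forall j, f (xs j) <= F1.
Proof.
have [B HB] := f_lower_bound; have [S HS] := zsum_bounded; have [Z zZ] := zbnd.
have k0 : 'I_K := Ordinal K0.
have Z0 j : sqnorm (zs j) <= Z ^+ 2.
  rewrite -norm2_sq lerXn2r ?nnegrE ?norm2_ge0//.
  exact: le_trans (norm2_ge0 _) (zZ 0%N).
have r2 : 0 <= (2 * rho)^-1 by rewrite invr_ge0 mulr_ge0// ltW.
(* Used in both directions: it bounds the Lagrangian below through [f], and then [f] above through
   the descent. *)
have fl j : f (xs j) - (2 * rho)^-1 * Z ^+ 2 <= lagr (xs j) (ys j) (zs j).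
  rewrite /lagr.
  have h1 := mulr_ge0 (ltW alpha0) (G_ge0 (ys_inY j)).
  have h2 := mulr_ge0 (divr_ge0 (ltW rho0) (ler0n R 2))
    (sqnorm_ge0 (ys j - Rm *m xs j + rho^-1 *: zs j)).
  have h3 := ler_wpM2l r2 (Z0 j).
  by lra.
have kappa0 : 0 < (mu - rho * specnorm Rm ^+ 2) / 2 by rewrite divr_gt0// subr_gt0.
have lB j : B - (2 * rho)^-1 * Z ^+ 2 <= lagr (xs j) (ys j) (zs j).
  apply: le_trans (fl j); rewrite lerD2r; apply: le_trans (HB j k0).
  by rewrite lerDl divr_ge0// ltW// bsum_xs_pos.
have eS n : \sum_(0 <= j < n) (rho^-1 * sqnorm (zs j.+1 - zs j)) <= rho^-1 * S.
  by rewrite -mulr_sumr ler_wpM2l// invr_ge0 ltW.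
have [dx la] := @perturbed_descent _ (fun j => lagr (xs j) (ys j) (zs j))
  (fun j => sqnorm (xs j.+1 - xs j)) (fun j => rho^-1 * sqnorm (zs j.+1 - zs j))
  _ _ _ kappa0 (fun j => sqnorm_ge0 _) lagr_descent lB eS.
split; first exact: vlim_of_sqnorm.
exists (lagr (xs 0%N) (ys 0%N) (zs 0%N) + rho^-1 * S + (2 * rho)^-1 * Z ^+ 2) => j.
by rewrite -lerBlDr; apply: le_trans (fl j) (la j).
Qed.

Lemma bsum_xs_away k : exists2 d, 0 < d & forall j, d <= bsum blk (xs j) k.
Proof.
have [B HB] := f_lower_bound; have [_ [F1 HF]] := descent_consequences.
have D j : s k / bsum blk (xs j) k <= F1 - B.
  by have := HB j k; have := HF j; lra.
have D0 : 0 < F1 - B by apply: lt_le_trans (D 0%N); rewrite divr_gt0// bsum_xs_pos.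
exists (s k / (F1 - B)) => [|j]; first by rewrite divr_gt0.
by rewrite ler_pdivrMr// mulrC -ler_pdivrMr// bsum_xs_pos.
Qed.

Lemma residual_to0 : vlim \oo (fun j => ys j - Rm *m xs j) 0.
Proof.
(* The multiplier update expresses the residual at [j.+1], hence the shift. *)
move=> i; rewrite -cvg_shiftS.
have -> : (fun j => (ys j.+1 - Rm *m xs j.+1) i 0) =
    (fun j => (rho^-1 *: (zs j.+1 - zs j)) i 0).
  apply/funext => j; rewrite zstep addrAC subrr add0r scalerA.
  by rewrite mulVf ?gt_eqF// scale1r.
by have := vlim_scale rho^-1 dz_to0; rewrite scaler0; apply.
Qed.

(** * Limit passage in the subproblems and stationarity *)

Section LimitPoint.
Variables (F : set_system nat) (xb : 'cV[R]_P) (yb zh : 'cV[R]_L).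
Hypotheses (FF : ProperFilter F) (F_oo : \oo `<=` F).
Hypotheses (xlim : vlim F xs xb) (ylim : vlim F ys yb) (zlim : vlim F zs zh).

Lemma limit_feasible : yb = Rm *m xb.
Proof.
have h : vlim F (fun j => ys j - Rm *m xs j) 0.
  exact: vlim_finer F_oo residual_to0.
pose proof (vlim_add ylim (vlim_opp (vlim_mulmx Rm xlim))) as h'.
by apply/eqP; rewrite -subr_eq0; apply/eqP; exact: (vlim_unique h' h).
Qed.

(** [F] need not be shift-invariant; the vanishing increments carry the limit to the next
    iterate. *)
Lemma xlim_next : vlim F (fun j => xs j.+1) xb.
Proof.
have h : vlim F (fun j => xs j.+1 - xs j) 0.
  by have [dx _] := descent_consequences; exact: vlim_finer F_oo dx.
pose proof (vlim_add h xlim) as h'; rewrite add0r in h' => i.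
by have := h' i; under eq_fun do rewrite subrK.
Qed.

(** The multiplier update gives [ys j.+1] as [Rm *m xs j.+1] plus a vanishing multiple of the
    multiplier increment. *)
Lemma ylim_next : vlim F (fun j => ys j.+1) yb.
Proof.
have h : vlim F (fun j => rho^-1 *: (zs j.+1 - zs j)) (rho^-1 *: 0).
  exact: vlim_scale (vlim_finer F_oo dz_to0).
pose proof (vlim_add h (vlim_mulmx Rm xlim_next)) as h'.
rewrite scaler0 add0r -limit_feasible in h'.
rewrite (_ : (fun j => _) = fun j => rho^-1 *: (zs j.+1 - zs j) + Rm *m xs j.+1)//.
apply/funext => j; rewrite zstep [zs j + _]addrC addrK scalerA mulVf ?gt_eqF// scale1r.
by rewrite subrK.
Qed.

Lemma limit_bsum_pos k : 0 < bsum blk xb k.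
Proof.
have [d d0 hd] := bsum_xs_away k.
have bk : bsum blk (xs j) k @[j --> F] --> bsum blk xb k by exact: bsum_cvg.
by apply: (lt_le_trans d0); apply: (cvgr_to_ge bk); exact: filterE.
Qed.

Lemma limit_inX : inX blk w xb.
Proof. exact: (inX_closed xs_inX xlim). Qed.

Lemma limit_inY : inY c yb.
Proof. exact: (inY_closed ys_inY ylim). Qed.

Lemma limit_x_optimal x : inX blk w x -> (forall k, 0 < bnorm1 blk x k) ->
  f xb + mu / 2 * sqnorm (- (mu^-1 *: (Rm^T *m zh)))
  <= f x + mu / 2 * sqnorm (x - xb - mu^-1 *: (Rm^T *m zh)).
Proof.
move=> xX xp.
(* Limit of the proximal centres: the residual disappears and [rho / mu * rho^-1] leaves [mu^-1]. *)
pose nub := xb + mu^-1 *: (Rm^T *m zh).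
have nulim : vlim F nu nub.
  pose proof (vlim_add xlim (vlim_scale (rho / mu) (vlim_mulmx Rm^T
    (vlim_add (vlim_add ylim (vlim_opp (vlim_mulmx Rm xlim))) (vlim_scale rho^-1 zlim))))) as h.
  rewrite limit_feasible subrr add0r -scalemxAr scalerA mulrAC divff in h; last by rewrite gt_eqF.
  by rewrite mul1r in h.
have -> : x - xb - mu^-1 *: (Rm^T *m zh) = x - nub by rewrite opprD addrA.
have -> : - (mu^-1 *: (Rm^T *m zh)) = xb - nub by rewrite opprD addrA subrr add0r.
pose proof (vlim_sqnorm (vlim_add xlim_next (vlim_opp nulim))) as l1.
pose proof (vlim_sqnorm (vlim_add (vlim_cst x) (vlim_opp nulim))) as l2.
have f1 : f (xs j.+1) @[j --> F] --> f xb.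
  exact: fsmooth_cvg xlim_next limit_bsum_pos.
pose proof (cvgD f1 (cvgM (cvg_cst (mu / 2)) l1)) as c1.
pose proof (cvgD (cvg_cst (f x)) (cvgM (cvg_cst (mu / 2)) l2)) as c2.
by apply: (ler_cvg_to c1 c2); apply: filterE => j; exact: x_optimal.
Qed.

Lemma limit_y_optimal y : inY c y ->
  alpha * G yb + rho / 2 * sqnorm (rho^-1 *: zh)
  <= alpha * G y + rho / 2 * sqnorm (y - yb + rho^-1 *: zh).
Proof.
(* Continuity of [G] is avoided: the ratio attaining [G yb] is frozen, and it bounds [G] from below
   at the iterates. *)
move=> yY; have [Gge Gex] := Gmax; have [l ->] := Gex yb.
pose proof (vlim_opp (vlim_mulmx Rm xlim_next)) as Rx; rewrite -limit_feasible in Rx.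
pose proof (vlim_scale rho^-1 zlim) as zr.
pose proof (vlim_sqnorm (vlim_add (vlim_add ylim_next Rx) zr)) as l1.
rewrite subrr add0r in l1.
pose proof (vlim_sqnorm (vlim_add (vlim_add (vlim_cst y) Rx) zr)) as l2.
have g1 : alpha * (ys j.+1 l 0 / c l 0) @[j --> F] --> alpha * (yb l 0 / c l 0).
  by apply: cvgM; [exact: cvg_cst|apply: cvgM; [exact: ylim_next|exact: cvg_cst]].
pose proof (cvgD g1 (cvgM (cvg_cst (rho / 2)) l1)) as c1.
pose proof (cvgD (cvg_cst (alpha * G y)) (cvgM (cvg_cst (rho / 2)) l2)) as c2.
apply: (ler_cvg_to c1 c2); apply: filterE => j.
apply: le_trans (y_optimal j yY); rewrite lerD2r ler_wpM2l ?(ltW alpha0)//.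
Qed.

(** The proximal square contributes a linear term in [Rm^T *m zh] and a quadratic one, which joins
    the Taylor remainder with total constant [C + mu / 2]. *)
Lemma limit_x_normal :
  limiting_subgrad (eindic (inX blk w)) xb (Rm^T *m zh - fsmooth_grad blk beta s xb).
Proof.
apply: eindic_subgrad limit_inX _ => e e0.
have [C [d [C0 d0 H]]] := fsmooth_taylor beta0 s0 limit_bsum_pos.
have C1 : 0 < C + mu / 2 by rewrite addr_gt0// divr_gt0.
have [d' [d'0 d'd hd']] := quadratic_small C1 d0 e0.
exists d'; split=> // u uX ud; have [up Hu] := H u (lt_le_trans ud d'd).
apply: le_trans (hd' _ (norm2_ge0 _) ud).
have up' k : 0 < bnorm1 blk u k by rewrite (bnorm1E _ uX).
have := limit_x_optimal uX up'; rewrite (sqnormD (u - xb)) [inner (u - xb) _]innerC.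
rewrite -scalerN innerZl innerNl innerDl innerNl.
move: Hu; rewrite ler_norml => /andP[_]; rewrite -/f -(norm2_sq (u - xb)).
move: (sqnorm _) (norm2 _) (inner (fsmooth_grad _ _ _ _) _) (inner (_ *m _) _) => a b g h.
have -> : mu / 2 * (b ^+ 2 + 2 * (mu^-1 * - h) + a) = mu / 2 * b ^+ 2 - h + mu / 2 * a.
  by field; rewrite gt_eqF.
by rewrite mulrDl; lra.
Qed.

(** Competitors on the segment from [yb] to [y] make the proximal term of order [t ^+ 2], so by
    convexity only first-order terms survive. *)
Lemma limit_y_linear_optimal y : inY c y ->
  alpha * G yb + inner zh yb <= alpha * G y + inner zh y.
Proof.
move=> yY; rewrite -subr_ge0.
have -> : alpha * G y + inner zh y - (alpha * G yb + inner zh yb) =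
    alpha * (G y - G yb) + inner zh (y - yb).
  by rewrite (innerC zh (y - yb)) innerDl innerNl !(innerC _ zh); ring.
apply: (@ge0_of_quadratic _ _ (rho / 2 * sqnorm (y - yb))).
  by rewrite mulr_ge0 ?sqnorm_ge0// divr_ge0// ltW.
move=> t /andP[t0 t1]; have t01 : 0 <= t <= 1 by rewrite t1 ltW.
have := limit_y_optimal (inY_convex limit_inY yY t01).
have := ler_wpM2l (ltW alpha0) (max_ratio_convex yb y Gmax t01).
have -> : yb + t *: (y - yb) - yb = t *: (y - yb) by rewrite addrAC subrr add0r.
rewrite sqnormD (innerC _ (rho^-1 *: _)) innerZl (innerC zh) innerZl.
rewrite (innerC _ zh) !sqnormZ.
move: (G (yb + _)) => Gt.
have -> : rho / 2 * (t ^+ 2 * sqnorm (y - yb) + 2 * (rho^-1 * (t * inner zh (y - yb))) +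
   rho^-1 ^+ 2 * sqnorm zh) = rho / 2 * sqnorm (y - yb) * t ^+ 2 +
   t * inner zh (y - yb) + rho / 2 * (rho^-1 ^+ 2 * sqnorm zh).
  by field; rewrite gt_eqF.
by lra.
Qed.

End LimitPoint.

(* Along an ultrafilter finer than the subsequence the bounded multipliers
   converge as well, so no further subsequence has to be extracted. *)
Lemma limit_point_ultrafilter xb yb : limit_point2 xs ys xb yb ->
  exists (F : set_system nat) (zh : 'cV[R]_L), [/\ ProperFilter F, \oo `<=` F,
    vlim F xs xb, vlim F ys yb & vlim F zs zh].
Proof.
move=> [phi [phi_inc [xc yc]]].
have xl := @vlim_of_vcvg _ _ phi xs xb xc; have yl := @vlim_of_vcvg _ _ phi ys yb yc.
have phi_ge k : (k <= phi k)%N.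
  by elim: k => // k IH; exact: leq_ltn_trans IH (phi_inc k).
have [F [FU subF]] := @ultraFilterLemma _ (phi @ \oo) _.
have [zh zl] := bounded_ultra_vlim FU zbnd.
exists F, zh; split; last exact: zl.
- exact: ultra_proper.
- move=> A [N _ NA]; apply: subF; exists N => // k /= Nk; apply: NA => /=.
  exact: leq_trans Nk (phi_ge k).
- exact: vlim_finer subF xl.
- exact: vlim_finer subF yl.
Qed.

Lemma limit_point_stationary xb yb : limit_point2 xs ys xb yb ->
  (forall k, 0 < bnorm1 blk xb k) /\
  exists zh : 'cV[R]_L,
    (exists gf nX : 'cV[R]_P,
       is_gradient (fsmooth blk beta s) xb gf /\
       limiting_subgrad (eindic (inX blk w)) xb nX /\
       gf + nX - Rm^T *m zh = 0) /\
    (exists gg nY : 'cV[R]_L,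
       limiting_subgrad (gobj alpha c) yb gg /\
       limiting_subgrad (eindic (inY c)) yb nY /\
       gg + nY + zh = 0) /\
    yb = Rm *m xb.
Proof.
move=> /limit_point_ultrafilter[F [zh [FF F_oo xl yl zl]]].
have bp := limit_bsum_pos FF xl.
split=> [k|]; first by rewrite (bnorm1E _ (limit_inX FF xl)).
exists zh; split; [|split; last exact: limit_feasible FF F_oo xl yl].
  exists (fsmooth_grad blk beta s xb), (Rm^T *m zh - fsmooth_grad blk beta s xb).
  split; first exact: fsmooth_is_gradient.
  split; first exact: limit_x_normal FF F_oo xl yl zl.
  by rewrite [_ + (_ - _)]addrC subrK subrr.
have [gg [nY [Hgg HnY E]]] := box_max_multiplier c0 alpha0 Gmax
  (limit_inY FF yl) (limit_y_linear_optimal FF F_oo xl yl zl).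
exists gg, nY; split; last split=> //.
  apply: frechet_limiting; split=> [|e e0]; first by rewrite GE.
  (* The subgradient inequality is global, so any radius serves. *)
  exists 1; split=> // u _; rewrite !GE lee_fin; apply: le_trans (Hgg u).
  by rewrite gerBl mulr_ge0 ?norm2_ge0// ltW.
apply: eindic_subgrad (limit_inY FF yl) _ => e e0; exists 1; split=> // u uY _.
by apply: (le_trans (HnY u uY)); rewrite mulr_ge0 ?norm2_ge0// ltW.
Qed.

End Algorithm.

Theorem theorem1 (R : realType) (K L P : nat) (blk : 'I_P -> 'I_K)
  (Rm : 'M[R]_(L, P)) (c : 'cV[R]_L) (w : 'I_K -> nat)
  (alpha beta : R) (s : 'I_K -> R) (rho mu : R)
  (xs : nat -> 'cV[R]_P) (ys zs : nat -> 'cV[R]_L) :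
  (0 < K)%N -> (0 < L)%N ->
  (forall i j : 'I_P, (i <= j)%N -> (blk i <= blk j)%N) ->
  (forall k : 'I_K, exists i, blk i = k) ->
  (forall l i, Rm l i = 0 \/ Rm l i = 1) ->
  (forall i, exists l, Rm l i != 0) ->
  (forall l, 0 < c l 0) ->
  (forall k, (1 <= w k)%N /\ (w k <= blocksize blk k)%N) ->
  0 < alpha -> 0 < beta -> (forall k, 0 < s k) ->
  0 < rho -> rho * specnorm Rm ^+ 2 < mu ->
  (* initial point *)
  inX blk w (xs 0%N) -> (forall k, 0 < bnorm1 blk (xs 0%N) k) -> inY c (ys 0%N) ->
  (* the iterations *)
  (forall j : nat,
     let q := Rm^T *m (ys j - Rm *m xs j + rho^-1 *: zs j) in
     let nu := xs j + (rho / mu) *: q in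
     [/\ inX blk w (xs j.+1) /\
         (forall x, inX blk w x ->
            (fobj blk beta s (xs j.+1) + (mu / 2 * sqnorm (xs j.+1 - nu))%:E
             <= fobj blk beta s x + (mu / 2 * sqnorm (x - nu))%:E)%E),
         inY c (ys j.+1) /\
         (forall y, inY c y ->
            (gobj alpha c (ys j.+1)
               + (rho / 2 * sqnorm (ys j.+1 - Rm *m xs j.+1 + rho^-1 *: zs j))%:E
             <= gobj alpha c y
               + (rho / 2 * sqnorm (y - Rm *m xs j.+1 + rho^-1 *: zs j))%:E)%E)
       & zs j.+1 = zs j + rho *: (ys j.+1 - Rm *m xs j.+1)]) ->
  (* assumptions of the theorem *)
  (\sum_(1 <= j <oo) (sqnorm (zs j.+1 - zs j))%:E < +oo)%E ->
  vbounded zs ->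
  (vbounded xs /\ vbounded ys) /\
  (forall (xb : 'cV[R]_P) (yb : 'cV[R]_L), limit_point2 xs ys xb yb ->
     (forall k, 0 < bnorm1 blk xb k) /\
     exists zh : 'cV[R]_L,
       (exists gf nX : 'cV[R]_P,
          is_gradient (fsmooth blk beta s) xb gf /\
          limiting_subgrad (eindic (inX blk w)) xb nX /\
          gf + nX - Rm^T *m zh = 0) /\
       (exists gg nY : 'cV[R]_L,
          limiting_subgrad (gobj alpha c) yb gg /\
          limiting_subgrad (eindic (inY c)) yb nY /\
          gg + nY + zh = 0) /\
       yb = Rm *m xb).

Proof.
move=> K0 L0 _ _ Rm01 Rmcol c0 _ alpha0 beta0 s0 rho0 rhomu xs0X xs0p ys0Y step zsum zbnd.
have [G Gmax GE] := gobj_max_ratio c alpha L0.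
have xstep j := let: And3 h _ _ := step j in h.
have ystep j := let: And3 _ h _ := step j in h.
have zstep j := let: And3 _ _ h := step j in h.
split; first split.
- exact: (xs_bounded Rm01 Rmcol c0 rho0 xs0X ys0Y xstep ystep zstep zbnd).
- exact: (ys_bounded ys0Y ystep).
- move=> xb yb; exact: (limit_point_stationary K0 Rm01 Rmcol c0 alpha0 beta0 s0 rho0 rhomu
    Gmax GE xs0X xs0p ys0Y xstep ystep zstep zsum zbnd).
Qed.
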